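(* Suppose that $T$ is a non-trivial group, $m\geqslant 2$ is an integer, and consider the diagonal group $D(T,m)$ as a permutation group on $\Omega=T^{m}$. Then the following are equivalent. (a) $D(T,m)$ is a primitive permutation group; (b) $D(T,m)$ is a quasiprimitive permutation group; (c) $T$ is a characteristically simple group, and, if $T$ is an elementary abelian $p$-group ($p$ prime), then $p\nmid(m+1)$.
   Context: $T$ may be finite or infinite. A permutation group is quasiprimitive if all its non-trivial normal subgroups are transitive. A subgroup of a group $G$ is characteristic if it is invariant under $\mathrm{Aut}(G)$; $G$ is characteristically simple if its only characteristic subgroups are $G$ and $1$. Diagonal group. The pre-diagonal group $\widehat D(T,m)$ is the semidirect product $T^{m+1}\rtimes(\mathrm{Aut}(T)\times S_{m+1})$, where $\mathrm{Aut}(T)$ acts in the same way on each factor and $S_{m+1}$ permutes the factors. Let $\delta(T,m+1)=\{(t,\ldots,t)\mid t\in T\}\leqslant T^{m+1}$ and $\widehat H=\delta(T,m+1)\rtimes(\mathrm{Aut}(T)\times S_{m+1})$. The diagonal group $D(T,m)$ is the permutation group induced by $\widehat D(T,m)$ on the right cosets of $\widehat H$. Numbering the factors of $T^{m+1}$ as $0,\ldots,m$ and writing $[t_1,\ldots,t_m]$ for the coset of $(1,t_1,\ldots,t_m)$, this coset set is identified with $\Omega=T^m$, and $D(T,m)$ is the permutation group on $T^m$ generated by: right multiplications of the $i$th coordinate by elements of $T$ ($1\leqslant i\leqslant m$); simultaneous left multiplication of all coordinates by an element of $T$; automorphisms of $T$ applied simultaneously to all coordinates; permutations of the $m$ coordinates;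 and the map $[t_1,t_2,\ldots,t_m]\mapsto[t_1^{-1},t_1^{-1}t_2,\ldots,t_1^{-1}t_m]$. *)

(* Defs.v *)
From Stdlib Require Import RelationClasses.
From HB Require Import structures.
From mathcomp Require Import all_boot all_fingroup.
From mathcomp Require Import boolp classical_sets.

Set Implicit Arguments.
Unset Strict Implicit.
Unset Printing Implicit Defensive.

Local Open Scope classical_set_scope.
Local Open Scope group_scope.

Section Groups.
Variable G : groupType.

Definition subgroup (H : set G) : Prop :=
  [/\ H 1, forall x y, H x -> H y -> H (x * y) & forall x, H x -> H x^-1].

Definition generated (A : set G) : set G := smallest subgroup A.

(* N <| H *)
Definition normal_subgroup (H N : set G) : Prop :=
  [/\ subgroup N, N `<=` H & forall x h, N x -> H h -> N (x ^ h)].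

Definition elementary_abelian (p : nat) : Prop :=
  (forall x y : G, x * y = y * x) /\ (forall x : G, x ^+ p = 1).

End Groups.

(* The symmetric group on an arbitrary, possibly infinite, type. *)
Record sym (X : Type) := Sym {
  sym_fun :> X -> X;
  sym_inv : X -> X;
  sym_funK : cancel sym_fun sym_inv;
  sym_invK : cancel sym_inv sym_fun
}.

Section SymGroup.
Variable X : Type.
Implicit Types f g h : sym X.

Lemma sym_ext f g : f =1 g -> f = g.
Proof.
case: f g => [f f' fK f'K] [g g' gK g'K] /= fg.
have {fg} E : f = g by exact/funext.
subst g.
have E : f' = g' by apply/funext => x; rewrite -{1}(g'K x) fK.
by subst g'; congr Sym; exact: Prop_irrelevance.
Qed.

(* As for 'S_n, permutations act on the right: f * g is "f, then g". *)
Definition sym_mul f g : sym X :=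
  Sym (can_comp (@sym_funK _ g) (@sym_funK _ f))
      (can_comp (@sym_invK _ f) (@sym_invK _ g)).

Definition sym_one : sym X := @Sym X id id (frefl id) (frefl id).

Definition sym_opp f : sym X := Sym (@sym_invK _ f) (@sym_funK _ f).

Lemma sym_mulA : associative sym_mul. Proof. by move=> f g h; exact: sym_ext. Qed.
Lemma sym_1mul : left_id sym_one sym_mul. Proof. by move=> f; exact: sym_ext. Qed.
Lemma sym_mul1 : right_id sym_one sym_mul. Proof. by move=> f; exact: sym_ext. Qed.
Lemma sym_Vmul : left_inverse sym_one sym_opp sym_mul.
Proof. by move=> f; apply: sym_ext => x /=; rewrite sym_invK. Qed.
Lemma sym_mulV : right_inverse sym_one sym_opp sym_mul.
Proof. by move=> f; apply: sym_ext => x /=; rewrite sym_funK. Qed.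

HB.instance Definition _ := gen_eqMixin (sym X).
HB.instance Definition _ := gen_choiceMixin (sym X).
HB.instance Definition _ :=
  isGroup.Build (sym X) sym_mulA sym_1mul sym_mul1 sym_Vmul sym_mulV.

End SymGroup.

Section PermutationGroups.
Variables (X : Type) (G : set (sym X)).

Definition transitive_group : Prop := forall x y, exists2 g, G g & g x = y.

Definition invariant_rel (e : X -> X -> Prop) : Prop :=
  forall g x y, G g -> e x y -> e (g x) (g y).

End PermutationGroups.

Definition primitive (X : Type) (G : set (sym X)) : Prop :=
  transitive_group G /\
  forall e, Equivalence e -> invariant_rel G e ->
    (forall x y, e x y -> x = y) \/ (forall x y, e x y).

Definition quasiprimitive (X : Type) (G : set (sym X)) : Prop :=
  forall N, normal_subgroup G N -> N <> [set 1] -> transitive_group N.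

Section Characteristic.
Variable T : groupType.

Definition automorphism (phi : sym T) : Prop := {morph phi : x y / x * y}.

Definition characteristic (H : set T) : Prop :=
  subgroup H /\ forall phi, automorphism phi -> phi @` H = H.

Definition characteristically_simple : Prop :=
  forall H, characteristic H -> H = [set 1] \/ H = setT.

End Characteristic.

Section Diagonal.
Variables (T : groupType) (m : nat).

(* [t_1, ..., t_m] is t : {ffun 'I_m -> T} with t_i = t (i - 1). *)
Local Notation Omega := {ffun 'I_m -> T}.

Definition right_mul : set (sym Omega) :=
  [set g : sym Omega | exists i a, forall t j, g t j = if j == i then t j * a else t j].

Definition left_mul : set (sym Omega) :=
  [set g : sym Omega | exists a, forall t j, g t j = a * t j].

Definition coord_aut : set (sym Omega) :=
  [set g : sym Omega | exists2 phi, automorphism phi & forall t j, g t j = phi (t j)].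

Definition coord_perm : set (sym Omega) :=
  [set g : sym Omega | exists s : 'S_m, forall t j, g t j = t (s j)].

(* [t_1, t_2, ..., t_m] |-> [t_1^-1, t_1^-1 t_2, ..., t_1^-1 t_m], which is the
   transposition of the factors 0 and 1 of T^(m+1); k is the first coordinate. *)
Definition swap01 : set (sym Omega) :=
  [set g : sym Omega | exists2 k : 'I_m, k = 0 :> nat &
     forall t j, g t j = if j == k then (t k)^-1 else (t k)^-1 * t j].

Definition diagonal_group : set (sym Omega) :=
  generated (right_mul `|` left_mul `|` coord_aut `|` coord_perm `|` swap01).

End Diagonal.

Arguments characteristically_simple T : clear implicits.
Arguments elementary_abelian G p : clear implicits.
Arguments diagonal_group T m : clear implicits.

(* Main.v *)
(** A primitive group is quasiprimitive because the orbits of a normal subgroup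
    are blocks. Conversely, in a quasiprimitive group, an invariant equivalence
    relation is universal as soon as some non-trivial group element fixes every
    class. If H is a non-trivial characteristic subgroup of T, this applies to
    congruence of all coordinates modulo H, and forces H = T; if T is elementary
    abelian and p divides m + 1, it would apply to equality of the products of
    the coordinates, which is preserved by x |-> swap x since that map
    multiplies the product by a (m + 1)-st power.

    Now let T be characteristically simple and let B be a block containing 1,
    which is a subgroup of T^m. The elements a with (a, 1, ..., 1) in B form a
    characteristic subgroup K; if K = T then B is everything. If K = 1 and B is
    not trivial, comparing a point of B with its image under a transposition
    gives (a, a^-1, 1, ..., 1) in B for some a <> 1. As m + 1 >= 3, commutators of
    such a lie in K = 1, so they form a characteristic subgroup, which is thus T,
    and T is abelian. Then B contains all x of product 1, and applying a swap to
    (a, a^-1, 1, ..., 1) yields a^(m+1) in K. So T has exponent dividing m + 1,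
    and being characteristically simple it is elementary abelian for some prime
    p dividing m + 1. *)
From Stdlib Require Import RelationClasses.
From HB Require Import structures.
From mathcomp Require Import all_boot all_fingroup.
From mathcomp Require Import boolp classical_sets.
Require Import Defs.

Set Implicit Arguments.
Unset Strict Implicit.
Unset Printing Implicit Defensive.

(** * Invariant equivalence relations and normal subgroups *)

Section PermutationGroups.
Local Open Scope classical_set_scope.
Local Open Scope group_scope.
Variable X : Type.
Implicit Types (G A : set (sym X)) (e : X -> X -> Prop).

Lemma sym_mulE (f g : sym X) x : (f * g) x = g (f x).
Proof. by []. Qed.

Lemma symKV (g : sym X) x : g (g^-1 x) = x.
Proof. exact: sym_invK. Qed.

Lemma symVK (g : sym X) x : g^-1 (g x) = x.
Proof. exact: sym_funK. Qed.

Lemma subgroup_generated A : subgroup (generated A).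
Proof.
split=> [H [[H1 _ _] _] // | x y xA yA H HA | x xA H HA].
- by have [[_ HM _] _] := HA; apply: HM; [exact: xA | exact: yA].
- by have [[_ _ HV] _] := HA; apply: HV; exact: xA.
Qed.

(** The equivalence in the hypothesis, unlike an implication, defines a set of permutations closed
    under inverses, hence a subgroup. *)
Lemma invariant_generated A e :
    (forall g x y, A g -> e (g x) (g y) <-> e x y) ->
  invariant_rel (generated A) e.
Proof.
move=> Ae g x y gA.
suff H : generated A `<=` [set h : sym X | forall x y, e (h x) (h y) <-> e x y].
  by move/(H g gA).
apply: smallest_sub => [|h /Ae hA]; last by move=> *; apply: hA.
split=> [//| f h fe he u v | f fe u v]; first by rewrite !sym_mulE he fe.
by rewrite -[X in X <-> _]fe !symKV.
Qed.

(** The elements of [G] fixing every class form a normal subgroup, non-trivial because of [g]. It is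
    therefore transitive, so any two points share a class. *)
Lemma quasiprimitive_invariant G e :
    subgroup G -> quasiprimitive G -> Equivalence e -> invariant_rel G e ->
    (exists2 g, G g & g <> 1 /\ forall x, e (g x) x) ->
  forall x y, e x y.
Proof.
move=> [G1 GM GV] qG [eR eS eT] eG [g gG [g1 ge]] x y.
pose N := [set h | G h /\ forall x, e (h x) x].
have nN : normal_subgroup G N.
  split=> [|h [] //|n h [nG ne] hG].
    split=> [|a b [aG ae] [bG be]|a [aG ae]].
    - by split=> // u; exact: eR.
    - by split=> [|u]; [exact: GM | exact: eT (be _) (ae _)].
    - by split=> [|u]; [exact: GV | apply: eS; rewrite -{1}[u](symKV a)].
  split=> [|u]; first by apply/GM/GM => //; exact: GV.
  by rewrite conjgE !sym_mulE -{2}[u](symKV h); apply: eG.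
have N1 : N <> [set 1] by move=> NE; apply: g1; have : N g by []; rewrite NE.
by have [h [_ he] <-] := qG N nN N1 x y; apply: eS.
Qed.

Lemma primitive_quasiprimitive G : primitive G -> quasiprimitive G.
Proof.
move=> [_ primG] N [[N1 NM NV] NG nN] N_neq1.
pose e x y := exists2 g, N g & g x = y.
have eqe : Equivalence e.
  split=> [x | x y [g gN <-] | x y z [g gN <-] [h hN <-]].
  - by exists 1.
  - by exists g^-1; [exact: NV | rewrite symVK].
  - by exists (g * h); [exact: NM |].
have invN : invariant_rel G e.
  move=> h x y hG [g gN <-]; exists (g ^ h); first exact: nN.
  by rewrite conjgE !sym_mulE symVK.
have [e_eq | //] := primG e eqe invN.
(* If all orbits of [N] are single points, every element of [N] is the identity. *)
case: N_neq1; apply/seteqP; split=> [g gN | _ -> //].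
by apply: sym_ext => x /=; apply/esym/e_eq; exists g.
Qed.

End PermutationGroups.

(** * Automorphisms and characteristic subgroups *)

Section Automorphisms.
Local Open Scope classical_set_scope.
Local Open Scope group_scope.
Variable T : groupType.
Implicit Types (phi : sym T) (H : set T).

Lemma automorphismV phi : automorphism phi -> automorphism phi^-1.
Proof.
by move=> phiM x y; apply: (can_inj (symVK phi)); rewrite phiM !symKV.
Qed.

Lemma automorphism1 phi : automorphism phi -> phi 1 = 1.
Proof. by move=> phiM; apply: (mulgI (phi 1)); rewrite -phiM !mulg1. Qed.

Lemma automorphismVg phi x : automorphism phi -> phi x^-1 = (phi x)^-1.
Proof.
by move=> phiM; apply/esym/mulg1_eq; rewrite -phiM mulgV automorphism1.
Qed.

Definition inner (a : T) : sym T := Sym (conjgK a) (conjgKV a).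

Lemma automorphism_inner a : automorphism (inner a).
Proof. by move=> x y; exact: conjMg. Qed.

(** Stability under [phi^-1] gives the reverse inclusion. *)
Lemma stable_characteristic H :
    subgroup H -> (forall phi x, automorphism phi -> H x -> H (phi x)) ->
  characteristic H.
Proof.
move=> sH HA; split=> // phi phiM; apply/seteqP; split=> [_ [x xH <-] | x xH].
  exact: HA.
by exists (phi^-1 x); [apply: HA => //; exact: automorphismV | exact: symKV].
Qed.

Lemma characteristic_aut H phi x :
  characteristic H -> automorphism phi -> H (phi x) <-> H x.
Proof.
move=> [_ cH] phiM; split=> [|xH]; last by rewrite -(cH phi phiM); exists x.
by rewrite -{1}(cH phi phiM) => -[y yH /(can_inj (symVK phi)) <-].
Qed.

Lemma characteristic_conj H x a : characteristic H -> H (x ^ a) <-> H x.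
Proof.
by move=> cH; exact: (characteristic_aut x cH (@automorphism_inner a)).
Qed.

End Automorphisms.

(** * The group T^m and the generators of the diagonal group *)

Section Coordinates.
Local Open Scope classical_set_scope.
Local Open Scope group_scope.
Variables (T : groupType) (m : nat).
Local Notation Omega := {ffun 'I_m -> T}.
Implicit Types (x y : Omega) (B : set Omega).

Definition single (i : 'I_m) (a : T) : Omega := [ffun j => if j == i then a else 1].

Lemma mulfE x y j : (x * y) j = x j * y j. Proof. exact: ffunE. Qed.
Lemma invfE x j : x^-1 j = (x j)^-1. Proof. exact: ffunE. Qed.
Lemma onefE j : (1 : Omega) j = 1. Proof. exact: ffunE. Qed.
Lemma singleE i a j : single i a j = if j == i then a else 1.
Proof. exact: ffunE. Qed.

Definition fE := (mulfE, invfE, onefE, singleE).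

Lemma singleM i a b : single i (a * b) = single i a * single i b.
Proof. by apply/ffunP => j; rewrite !fE; case: eqP; rewrite ?mulg1. Qed.

Lemma singleV i a : single i a^-1 = (single i a)^-1.
Proof. by apply/ffunP => j; rewrite !fE; case: eqP; rewrite ?invg1. Qed.

Lemma single1 i : single i 1 = 1.
Proof. by apply/ffunP => j; rewrite !fE if_same. Qed.

Lemma single_ind B :
    B 1 -> (forall x y, B x -> B y -> B (x * y)) -> (forall i a, B (single i a)) ->
  forall x, B x.
Proof.
move=> B1 BM BS x.
(* Induction on the truncation of [x] to its first [n] coordinates. *)
suff H n : n <= m -> B [ffun j : 'I_m => if j < n then x j else 1].
  by have := H m (leqnn m); congr B; apply/ffunP => j; rewrite ffunE ltn_ord.
elim: n => [_ | n IHn n_lt_m].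
  by have := B1; congr B; apply/ffunP => j; rewrite !ffunE.
have := BM _ _ (IHn (ltnW n_lt_m)) (BS (Ordinal n_lt_m) (x (Ordinal n_lt_m))).
congr B; apply/ffunP => j; rewrite !ffunE ltnS -val_eqE /=.
case: (ltngtP j n) => //= jn; rewrite ?mulg1 ?mul1g //.
by congr (x _); apply: val_inj.
Qed.

(* The transposition of the factors 0 and k + 1 of T^(m+1); [swap01] is k = 0. *)
Definition swap (k : 'I_m) x : Omega :=
  [ffun j => if j == k then (x k)^-1 else (x k)^-1 * x j].

Lemma swapE k x j :
  swap k x j = if j == k then (x k)^-1 else (x k)^-1 * x j.
Proof. exact: ffunE. Qed.

Lemma swapK k : involutive (swap k).
Proof.
move=> x; apply/ffunP => j; rewrite !swapE eqxx invgK.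
by case: eqP => [-> // | _]; rewrite mulVKg.
Qed.

Definition permute (s : 'S_m) x : Omega := [ffun j => x (s j)].

Lemma permute_can s : cancel (permute s) (permute s^-1).
Proof. by move=> x; apply/ffunP => j; rewrite !ffunE permKV. Qed.

Lemma permute_canV s : cancel (permute s^-1) (permute s).
Proof. by move=> x; apply/ffunP => j; rewrite !ffunE permK. Qed.

Lemma permute_single s i a : permute s (single (s i) a) = single i a.
Proof.
by apply/ffunP => j; rewrite ffunE !singleE (inj_eq perm_inj).
Qed.

Definition map_aut (phi : sym T) x : Omega := [ffun j => phi (x j)].

Lemma map_autK phi : cancel (map_aut phi) (map_aut phi^-1).
Proof. by move=> x; apply/ffunP => j; rewrite !ffunE symVK. Qed.

Lemma map_autKV phi : cancel (map_aut phi^-1) (map_aut phi).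
Proof. by move=> x; apply/ffunP => j; rewrite !ffunE symKV. Qed.

Definition translation (a : Omega) : sym Omega := Sym (mulgK a) (mulgVK a).

Local Notation G := (diagonal_group T m).

Lemma diagonal_subgroup : subgroup G.
Proof. exact: subgroup_generated. Qed.

Lemma diagonal_translation a : G (translation a).
Proof.
have [G1 GM _] := diagonal_subgroup.
apply: (single_ind (B := [set b | G (translation b)])) => [|b c bG cG|i b] /=.
- by have := G1; congr G; apply: sym_ext => x; rewrite /= mulg1.
- by have := GM _ _ bG cG; congr G; apply: sym_ext => x; rewrite /= mulgA.
- apply: sub_gen_smallest; do 4!left; exists i, b => t j.
  by rewrite /= !fE; case: eqP; rewrite ?mulg1.
Qed.

Lemma diagonal_transitive : transitive_group G.
Proof.
move=> x y; exists (translation (x^-1 * y)); first exact: diagonal_translation.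
exact: mulVKg.
Qed.

Lemma diagonal_perm s : G (Sym (permute_can s) (permute_canV s)).
Proof. by apply: sub_gen_smallest; left; right; exists s => t j; rewrite ffunE. Qed.

Lemma diagonal_aut phi :
  automorphism phi -> G (Sym (map_autK phi) (map_autKV phi)).
Proof.
move=> phiM; apply: sub_gen_smallest; do 2!left; right.
by exists phi => // t j; rewrite ffunE.
Qed.

Lemma diagonal_swap (k : 'I_m) : k = 0 :> nat -> G (Sym (swapK k) (swapK k)).
Proof.
by move=> k0; apply: sub_gen_smallest; right; exists k => // t j; rewrite swapE.
Qed.

(** For [swap k] an implication suffices, since it is an involution. *)
Lemma diagonal_invariant (e : Omega -> Omega -> Prop) :
    (forall i a x y, e (x * single i a) (y * single i a) <-> e x y) ->
    (forall a x y, e ([ffun=> a] * x) ([ffun=> a] * y) <-> e x y) ->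
    (forall phi x y, automorphism phi -> e (map_aut phi x) (map_aut phi y) <-> e x y) ->
    (forall s x y, e (permute s x) (permute s y) <-> e x y) ->
    (forall k x y, e x y -> e (swap k x) (swap k y)) ->
  invariant_rel G e.
Proof.
move=> eR eL eA eP eS; apply: invariant_generated => g x y.
case=> [[[[]|]|]|].
- move=> [i [a gE]]; rewrite -(eR i a x y).
  have H z : g z = z * single i a; last by rewrite !H.
  by apply/ffunP => j; rewrite gE !fE; case: eqP; rewrite ?mulg1.
- move=> [a gE]; rewrite -(eL a x y).
  have H z : g z = [ffun=> a] * z; last by rewrite !H.
  by apply/ffunP => j; rewrite gE !ffunE.
- move=> [phi phiM gE]; rewrite -(eA _ x y phiM).
  have H z : g z = map_aut phi z; last by rewrite !H.
  by apply/ffunP => j; rewrite gE ffunE.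
- move=> [s gE]; rewrite -(eP s x y).
  have H z : g z = permute s z; last by rewrite !H.
  by apply/ffunP => j; rewrite gE ffunE.
- move=> [k _ gE].
  have {}gE z : g z = swap k z by apply/ffunP => j; rewrite gE swapE.
  by rewrite !gE; split=> [/(eS k)|/eS //]; rewrite !swapK.
Qed.

End Coordinates.

(** * The product of the coordinates when T is abelian *)

Section CommutativeProduct.
Local Open Scope group_scope.
Variables (T : groupType) (m : nat).
Hypothesis mulC : commutative (@mul T).
Local Notation Omega := {ffun 'I_m -> T}.

#[local] HB.instance Definition _ := SemiGroup.isCommutativeLaw.Build T (@mul T) mulC.

Definition ffun_prod (x : Omega) : T := \big[@mul T/1]_j x j.

Lemma ffun_prodM : {morph ffun_prod : x y / x * y}.
Proof. by move=> x y; rewrite -big_split; apply: eq_bigr => j _; rewrite mulfE. Qed.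

Lemma ffun_prod1 : ffun_prod 1 = 1.
Proof. by apply: big1 => j _; rewrite onefE. Qed.

Lemma ffun_prod_single i a : ffun_prod (single i a) = a.
Proof.
rewrite /ffun_prod (bigD1 i) //= singleE eqxx big1 ?mulg1 // => j /negPf ji.
by rewrite singleE ji.
Qed.

Lemma ffun_prod_const a : ffun_prod [ffun=> a] = a ^+ m.
Proof.
rewrite -[in RHS](card_ord m) -prodg_const.
by apply: eq_bigr => j _; rewrite ffunE.
Qed.

Lemma ffun_prod_permute s x : ffun_prod (permute s x) = ffun_prod x.
Proof.
rewrite /ffun_prod [RHS](reindex_inj (@perm_inj _ s)).
by apply: eq_bigr => j _; rewrite ffunE.
Qed.

Lemma ffun_prod_aut phi x :
  automorphism phi -> ffun_prod (map_aut phi x) = phi (ffun_prod x).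
Proof.
move=> phiM; rewrite /ffun_prod (big_morph phi phiM (automorphism1 phiM)).
by apply: eq_bigr => j _; rewrite ffunE.
Qed.

(** [swap k] multiplies all [m] coordinates on the left by [(x k)^-1], and coordinate [k] once more
    on the right. *)
Lemma ffun_prod_swap k x : ffun_prod (swap k x) = (x k)^-1 ^+ m.+1 * ffun_prod x.
Proof.
have -> : swap k x = [ffun=> (x k)^-1] * x * single k (x k)^-1.
  apply/ffunP => j; rewrite swapE !fE ffunE.
  by case: eqP => [->|]; rewrite ?mulg1 ?mulVg ?mul1g.
by rewrite !ffun_prodM ffun_prod_single ffun_prod_const mulC mulgA -expgS.
Qed.

End CommutativeProduct.

(** * Quasiprimitivity forces the conditions on T *)

Section Necessity.
Local Open Scope classical_set_scope.
Local Open Scope group_scope.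
Variables (T : groupType) (m : nat).
Hypothesis m_ge2 : (1 < m)%N.
Local Notation Omega := {ffun 'I_m -> T}.
Hypothesis qG : quasiprimitive (diagonal_group T m).

Lemma quasiprimitive_characteristically_simple : characteristically_simple T.
Proof.
move=> H cH; have [[H1 HM HV] _] := cH.
have [[h [hH h1]]|noh] := pselect (exists h, H h /\ h <> 1); last first.
  left; apply/seteqP; split=> [x xH | _ -> //].
  by apply: contrapT => x1; apply: noh; exists x.
right; apply/seteqP; split=> // t _.
pose i0 := Ordinal (ltnW m_ge2).
(* Coordinatewise equality of right cosets of [H], which is normal because it is characteristic. *)
pose e (x y : Omega) := forall j, H (x j * (y j)^-1).
have HVE x y : H (x * y^-1) -> H (y * x^-1) by move/HV; rewrite invMg invgK.
have HC x a : H x -> H (a^-1 * x * a).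
  by move=> xH; rewrite -mulgA -conjgE; apply/characteristic_conj.
suff : e [ffun=> t] 1 by move/(_ i0); rewrite !ffunE invg1 mulg1.
apply: (quasiprimitive_invariant (@diagonal_subgroup T m) qG) => {t}.
- split=> [x j|x y xy j|x y z xy yz j]; first by rewrite mulgV.
    exact/HVE/xy.
  by have := HM _ _ (xy j) (yz j); rewrite mulgA mulgVK.
- apply: diagonal_invariant.
  + by move=> i a x y; split=> xy j; have := xy j; rewrite !mulfE invMg mulgA mulgK.
  + move=> a x y.
    have E j : ([ffun=> a] * x) j * (([ffun=> a] * y) j)^-1
               = (x j * (y j)^-1) ^ a^-1.
      by rewrite !ffunE conjgE invgK invMg !mulgA.
    by split=> xy j; have := xy j; rewrite E characteristic_conj.
  + move=> phi x y phiM.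
    have E j : map_aut phi x j * (map_aut phi y j)^-1 = phi (x j * (y j)^-1).
      by rewrite !ffunE phiM automorphismVg.
    by split=> xy j; have := xy j; rewrite E characteristic_aut.
  + move=> s x y; split=> xy j; last by rewrite !ffunE.
    by have := xy (s^-1 j); rewrite !ffunE permKV.
  + move=> k x y xy j; rewrite !swapE; have xyk := xy k.
    have Hk : H ((x k)^-1 * y k).
      by have := HC _ (x k) (HVE _ _ xyk); rewrite mulgA mulgVK.
    case: eqP => _; first by rewrite invgK.
    rewrite invMg invgK.
    (* A conjugate of [x j * (y j)^-1] times [(x k)^-1 * y k], both in [H]. *)
    have -> : (x k)^-1 * x j * ((y j)^-1 * y k)
              = ((x k)^-1 * (x j * (y j)^-1) * x k) * ((x k)^-1 * y k).
      by rewrite !mulgA mulgK.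
    by apply: HM => //; apply: HC.
(* Right multiplication by [h] preserves right cosets of the normal subgroup [H]. *)
- exists (translation (single i0 h)); first exact: diagonal_translation.
  split=> [E|x j].
    apply: h1; have := congr1 (fun g : sym Omega => g 1 i0) E.
    by rewrite /= mul1g singleE eqxx onefE.
  rewrite /= mulfE singleE; case: eqP => _; last by rewrite mulg1 mulgV.
  by have := HC _ (x j)^-1 hH; rewrite invgK.
Qed.

Lemma quasiprimitive_elementary_abelian p :
    (exists x : T, x <> 1) -> elementary_abelian T p -> ~~ (p %| m + 1)%N.
Proof.
move=> [t t1] [mulC expp]; apply/negP => /dvdnP[q mE].
have expm (a : T) : a ^+ m.+1 = 1 by rewrite -addn1 mE mulnC expgnA expp expg1n.
pose i0 := Ordinal (ltnW m_ge2); pose i1 := Ordinal m_ge2.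
pose e (x y : Omega) := ffun_prod x = ffun_prod y.
suff : e (single i0 t) (single i0 1) by rewrite /e !(ffun_prod_single mulC).
apply: (quasiprimitive_invariant (@diagonal_subgroup T m) qG).
- by split=> [x|x y|x y z] //; rewrite /e => ->.
- apply: diagonal_invariant; rewrite /e.
  + by move=> i a x y; rewrite !(ffun_prodM mulC); split=> [/mulIg|->].
  + by move=> a x y; rewrite !(ffun_prodM mulC); split=> [/mulgI|->].
  + move=> phi x y phiM; rewrite !ffun_prod_aut //.
    by split=> [/(can_inj (symVK phi))|->].
  + by move=> s x y; rewrite !(ffun_prod_permute mulC).
  + by move=> k x y xy; rewrite !(ffun_prod_swap mulC) !expm xy.
(* Translation by (t, t^-1, 1, ..., 1) is non-trivial but keeps the product of the coordinates. *)
- exists (translation (single i0 t * single i1 t^-1)).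
    exact: diagonal_translation.
  split=> [E|x].
    apply: t1; have := congr1 (fun g : sym Omega => g 1 i0) E.
    by rewrite /= mul1g !fE eqxx mulg1.
  by rewrite /e !(ffun_prodM mulC) !(ffun_prod_single mulC) mulgV mulg1.
Qed.

End Necessity.

(** * Subgroups of T^m with the closure properties of a block containing 1 *)

Section Blocks.
Local Open Scope classical_set_scope.
Local Open Scope group_scope.
Variables (T : groupType) (m : nat).
Hypothesis m_ge2 : (1 < m)%N.
Local Notation Omega := {ffun 'I_m -> T}.
Variable B : set Omega.
Hypotheses (B1 : B 1) (BM : forall x y, B x -> B y -> B (x * y))
  (BV : forall x, B x -> B x^-1)
  (Baut : forall phi x, automorphism phi -> B x -> B (map_aut phi x))
  (Bperm : forall s x, B x -> B (permute s x))
  (Bswap0 : forall (k : 'I_m) x, k = 0 :> nat -> B x -> B (swap k x)).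

(** [swap k] is the conjugate of [swap i0] by the coordinate transposition of [k] and [i0]. *)
Lemma Bswap k x : B x -> B (swap k x).
Proof.
move=> xB; pose i0 : 'I_m := Ordinal (ltnW m_ge2).
have := Bperm (tperm k i0) (Bswap0 (k := i0) erefl (Bperm (tperm k i0) xB)).
congr B; apply/ffunP => j; rewrite !ffunE tpermR tpermK.
by rewrite -{2}(tpermL k i0) (inj_eq perm_inj).
Qed.

Lemma Bsingle i j a : B (single i a) -> B (single j a).
Proof.
by move=> /(Bperm (tperm i j)); rewrite -{2}(tpermR i j) permute_single.
Qed.

Definition pair i j a : Omega := single i a * single j a^-1.

Lemma Bpair i j i' j' a : i != j -> i' != j' -> B (pair i j a) -> B (pair i' j' a).
Proof.
(* [s] maps [i'] to [i] and [j'] to [j]: the first factor sends [j'] to [j1], and the second sends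
   [j1] to [j] while fixing [i]. *)
move=> ij ij'; pose j1 := tperm i' i j'; pose s := tperm i' i * tperm j1 j.
have si : s i' = i.
  rewrite permM tpermL tpermD // 1?eq_sym // /j1.
  by rewrite -{1}(tpermL i' i) (inj_eq perm_inj).
have sj : s j' = j by rewrite permM tpermL.
move=> /(Bperm s); congr B; rewrite /pair -(permute_single s i') -(permute_single s j').
by rewrite si sj; apply/ffunP => k; rewrite !ffunE.
Qed.

Definition single_part : set T := [set a | forall i, B (single i a)].
Definition pair_part : set T := [set a | forall i j, i != j -> B (pair i j a)].

Lemma characteristic_single_part : characteristic single_part.
Proof.
apply: stable_characteristic.
  split=> [i|a b aB bB i|a aB i]; first by rewrite single1.
    by rewrite singleM; exact: BM.
  by rewrite singleV; exact: BV.
move=> phi a phiM aB i; have := Baut phiM (aB i); congr B.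
by apply/ffunP => j; rewrite !ffunE; case: eqP; rewrite ?automorphism1.
Qed.

(** If two coordinates of [x] differ, dividing a transposed copy by [x] leaves a pair. If all equal
    c, [swap i0] yields (c^-1, 1, ..., 1), and pairs are products of such elements. *)
Lemma pair_part_nontrivial x :
  B x -> x <> 1 -> exists2 a, pair_part a & a <> 1.
Proof.
move=> xB x1.
have [[i [j xij]]|xcst] := pselect (exists i j, x i <> x j).
  have ij : i != j by apply/eqP => ijE; case: xij; rewrite ijE.
  exists ((x i)^-1 * x j); last by move/mulg1_eq; rewrite invgK.
  move=> i' j' ij'; apply: (Bpair ij ij').
  have := BM (BV xB) (Bperm (tperm i j) xB); congr B.
  apply/ffunP => k; rewrite !fE ffunE.
  case: tpermP => [->|->|/eqP/negPf-> /eqP/negPf->].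
  - by rewrite eqxx (negPf ij) mulg1.
  - by rewrite eqxx eq_sym (negPf ij) mul1g invMg invgK.
  - by rewrite mulVg mulg1.
pose i0 : 'I_m := Ordinal (ltnW m_ge2).
have xE j : x j = x i0 by apply: contrapT => E; apply: xcst; exists j, i0.
exists (x i0)^-1 => [i j _|E]; last first.
  by apply: x1; apply/ffunP => j; rewrite onefE xE -[LHS]invgK E invg1.
have sB : B (single i0 (x i0)^-1).
  have := Bswap i0 xB; congr B; apply/ffunP => k.
  by rewrite swapE singleE xE mulVg.
apply: BM; first exact: Bsingle sB.
by rewrite singleV; apply: BV; exact: Bsingle sB.
Qed.

(* On the factors 0, 1, 2 of T^(m+1), this comes from the commutator of
   (1, a, a^-1) and (b, 1, b^-1), which is supported on factor 2 alone. *)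
Lemma pair_part_commutator a b :
  pair_part a -> pair_part b -> single_part (a * (a^-1) ^ b^-1).
Proof.
move=> aL bL i; pose i0 : 'I_m := Ordinal (ltnW m_ge2); pose i1 := Ordinal m_ge2.
apply: (@Bsingle i1).
have vB := Bswap i0 (bL i0 i1 isT).
set v := swap _ _ in vB; have aB := aL i0 i1 isT.
(* Here v = (b^-1, b^-2, b^-1, ..., b^-1). Conjugating by v and then by b in every coordinate fixes
   coordinate 0 of the pair of [a] and conjugates coordinate 1 by b^-1. *)
have yB := Baut (@automorphism_inner T b) (BM (BV vB) (BM aB vB)).
rewrite -[a * _]invgK singleV; apply: BV.
have := BM (BV yB) aB; congr B; apply/ffunP => j.
have i01 : (i0 == i1) = false by [].
have vE k : v k = b^-1 * (if k == i1 then b^-1 else 1).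
  rewrite swapE !fE eqxx i01 mulg1.
  by case: (eqVneq k i0) => [->|_]; rewrite ?i01 ?mulg1 ?mul1g.
rewrite !fE ffunE /= !fE vE; have [->|ji1] := eqVneq j i1.
  by rewrite [i1 == i0]eq_sym i01 !conjgE !gnorm.
by case: eqP => _; rewrite conjgE !gnorm.
Qed.

(** The product of two pairs has a^-1 b^-1 = (b a)^-1 in its second place, which must equal (a
    b)^-1. *)
Lemma characteristic_pair_part :
  {in pair_part &, commutative (@mul T)} -> characteristic pair_part.
Proof.
move=> LC; apply: stable_characteristic.
  split=> [i j ij|a b aL bL i j ij|a aL i j ij].
  - by rewrite /pair invg1 !single1 mulg1.
  - have := BM (aL i j ij) (bL i j ij); congr B; apply/ffunP => k.
    rewrite !fE; have [->|_] := eqVneq k i; first by rewrite (negPf ij) !mulg1.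
    case: eqP => _; rewrite ?mulg1 // !mul1g -invMg.
    by congr _^-1; apply: LC; rewrite inE.
  - have := BV (aL i j ij); congr B; apply/ffunP => k.
    rewrite !fE; have [->|_] := eqVneq k i; first by rewrite (negPf ij) !mulg1.
    by rewrite !mul1g; case: eqP; rewrite ?invg1.
move=> phi a phiM aL i j ij; have := Baut phiM (aL i j ij); congr B.
apply/ffunP => k; rewrite ffunE !fE phiM.
by case: eqP; case: eqP; rewrite ?automorphismVg // ?automorphism1.
Qed.

(** The corrected point has product 1 and depends multiplicatively on [x]; for [single i a] with
    [i != k] it is a pair. *)
Lemma block_prod (mulC : commutative (@mul T)) :
  pair_part = setT -> forall k x, B (x * single k (ffun_prod x)^-1).
Proof.
move=> LT k; apply: (single_ind (B := [set x | B (x * single k (ffun_prod x)^-1)])) => /=.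
- by rewrite ffun_prod1 invg1 single1 mulg1.
- move=> x y xB yB; have := BM xB yB; congr B; apply/ffunP => j.
  rewrite (ffun_prodM mulC) invMg !fE; case: eqP => _; last by rewrite !mulg1.
  by rewrite -!mulgA; congr (_ * _); rewrite [LHS]mulC -mulgA.
- move=> i a; rewrite (ffun_prod_single mulC).
  have [->|ik] := eqVneq i k; first by rewrite -singleM mulgV single1.
  have aL : pair_part a by rewrite LT.
  exact: aL.
Qed.

Lemma block_exponent (mulC : commutative (@mul T)) :
  pair_part = setT -> forall a, single_part (a ^+ m.+1).
Proof.
move=> LT a i; pose i0 : 'I_m := Ordinal (ltnW m_ge2); pose i1 := Ordinal m_ge2.
apply: (@Bsingle i0).
have aL : pair_part a^-1 by rewrite LT.
have aB := aL i0 i1 isT.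
have vB := Bswap i0 aB; set v := swap _ _ in vB.
have vP : ffun_prod v = a ^+ m.+1.
  rewrite (ffun_prod_swap mulC) (ffun_prodM mulC) !(ffun_prod_single mulC).
  by rewrite !fE eqxx !mulg1 mulgV mulg1 invgK.
(* Both [v] and its correction to product 1 lie in [B]; their quotient is
   [single i0 (a ^+ m.+1)]. *)
have := BM (BV (block_prod mulC LT i0 v)) vB.
by rewrite vP invMg singleV invgK mulgVK.
Qed.

End Blocks.

(** * The conditions on T force primitivity *)

Section Sufficiency.
Local Open Scope classical_set_scope.
Local Open Scope group_scope.
Variables (T : groupType) (m : nat).
Local Notation Omega := {ffun 'I_m -> T}.

(** With p the least prime divisor of [n], either t^(n/p) is the required element or it is 1 and n/p
    replaces [n]. *)
Lemma exists_prime_order (t : T) n : (0 < n)%N -> t <> 1 -> t ^+ n = 1 ->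
  exists p u, [/\ prime p, (p %| n)%N, u <> 1 :> T & u ^+ p = 1].
Proof.
elim/ltn_ind: n => n IHn n0 t1 tn.
have n1 : (1 < n)%N.
  by case: n n0 tn {IHn} => [|[|n]] // _; rewrite expg1 => /t1.
have nE := divnK (pdiv_dvd n); have q0 : (0 < n %/ pdiv n)%N.
  by rewrite divn_gt0 ?pdiv_gt0 // dvdn_leq ?pdiv_dvd.
have [tq|tq] := pselect (t ^+ (n %/ pdiv n) = 1).
  have [|p [u [pp pn u1 up]]] := IHn _ _ q0 t1 tq.
    by rewrite ltn_Pdiv // prime_gt1 // pdiv_prime.
  by exists p, u; split=> //; rewrite -nE dvdn_mulr.
exists (pdiv n), (t ^+ (n %/ pdiv n)); split=> //; first exact: pdiv_prime.
  exact: pdiv_dvd.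
by rewrite -expgnA nE.
Qed.

(** As T is abelian, the solutions of x^p = 1 form a characteristic subgroup; for a suitable p it is
    non-trivial, hence all of T. *)
Lemma characteristically_simple_exponent n :
    commutative (@mul T) -> characteristically_simple T ->
    (exists x : T, x <> 1) -> (0 < n)%N -> (forall x : T, x ^+ n = 1) ->
  exists p, [/\ prime p, (p %| n)%N & elementary_abelian T p].
Proof.
move=> mulC cT [t t1] n0 expn.
have [p [u [pp pn u1 up]]] := exists_prime_order n0 t1 (expn t).
exists p; split=> //; split=> //.
pose H : set T := [set x | x ^+ p = 1].
have cH : characteristic H.
  apply: stable_characteristic.
    split=> [|x y xH yH|x xH]; first exact: expg1n.
      by rewrite /H /= (expgMn _ (mulC x y)) xH yH mulg1.
    by rewrite /H /= expVgn xH invg1.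
  move=> phi x phiM xH; have phi1 := automorphism1 phiM.
  rewrite /H /= -phi1 -{}xH; elim: {pp pn up H} p => [|p IHp].
    by rewrite !expg0.
  by rewrite !expgS IHp phiM.
have [H1|HT] := cT _ cH.
  by case: u1; have : H u by []; rewrite H1.
by move=> x; have : H x by rewrite HT.
Qed.

Lemma diagonal_primitive : (1 < m)%N -> (exists x : T, x <> 1) ->
    characteristically_simple T ->
    (forall p, prime p -> elementary_abelian T p -> ~~ (p %| m + 1)%N) ->
  primitive (diagonal_group T m).
Proof.
move=> m_ge2 T1 cT Tp; split; first exact: diagonal_transitive.
move=> e [eR eS eT] eG.
have eM x y z : e x y -> e (x * z) (y * z).
  by move/(eG _ _ _ (diagonal_translation z)).
pose B : set Omega := [set x | e 1 x].
have B1 : B 1 by exact: eR.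
have BM x y : B x -> B y -> B (x * y).
  by move=> /(eM _ _ y); rewrite mul1g => xy yB; apply: eT xy.
have BV x : B x -> B x^-1.
  by move=> /(eM _ _ x^-1); rewrite mul1g mulgV => /eS.
have Baut phi x : automorphism phi -> B x -> B (map_aut phi x).
  move=> phiM /(eG _ _ _ (diagonal_aut phiM)); congr e.
  by apply/ffunP => j; rewrite /= ffunE onefE automorphism1.
have Bperm s x : B x -> B (permute s x).
  move=> /(eG _ _ _ (diagonal_perm s)); congr e.
  by apply/ffunP => j; rewrite /= ffunE !onefE.
have Bswap0 (k : 'I_m) x : k = 0 :> nat -> B x -> B (swap k x).
  move=> k0 /(eG _ _ _ (diagonal_swap k0)); congr e.
  by apply/ffunP => j; rewrite /= swapE !onefE invg1 mulg1 if_same.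
have [[x [xB x1]]|B_triv] := pselect (exists x, B x /\ x <> 1); last first.
  (* Translating by [x^-1] moves any related pair to one starting at 1. *)
  left=> x y xy; apply: contrapT => yx; apply: B_triv; exists (y * x^-1); split.
    by have := eM _ _ x^-1 xy; rewrite mulgV.
  by move/divg1_eq => yxE; apply: yx.
right; suff BT z : B z by move=> y z; exact: eT (eS _ _ (BT y)) (BT z).
have KcT := characteristic_single_part B1 BM BV Baut.
have [K1|KT] := cT _ KcT; last first.
  apply: single_ind => // i a.
  have aK : single_part B a by rewrite KT.
  exact: aK.
have K_eq1 a : single_part B a -> a = 1 by rewrite K1.
have LC : {in pair_part B &, commutative (@mul T)}.
  move=> a b /set_mem aL /set_mem bL.
  have /K_eq1 := pair_part_commutator m_ge2 BM BV Baut Bperm Bswap0 aL bL.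
  (* The commutator a b a^-1 b^-1 is 1, so [a] and [b] commute. *)
  rewrite conjgE invgK => /mulg1_eq/(congr1 (@inv T)).
  by rewrite !invMg !invgK => {1}->; rewrite mulgVK.
have [L1|LT] := cT _ (characteristic_pair_part B1 BM BV Baut LC).
  have [a aL a1] := pair_part_nontrivial m_ge2 BM BV Bperm Bswap0 xB x1.
  by case: a1; move: aL; rewrite L1.
have mulC : commutative (@mul T) by move=> a b; apply: LC; rewrite LT in_setT.
have expm (a : T) : a ^+ m.+1 = 1.
  exact/K_eq1/(block_exponent m_ge2 B1 BM BV Bperm Bswap0 mulC LT).
have [p [pp pm Tab]] := characteristically_simple_exponent mulC cT T1 (ltn0Sn m) expm.
by have := Tp p pp Tab; rewrite addn1 pm.
Qed.

End Sufficiency.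

(** * Equivalence of primitivity, quasiprimitivity and the conditions on T *)

Theorem theorem1p6 (T : groupType) (m : nat)
    (T_nontrivial : exists x : T, x <> 1%g) (m_ge2 : 2 <= m) :
  [<-> primitive (diagonal_group T m);
       quasiprimitive (diagonal_group T m);
       characteristically_simple T /\
       (forall p : nat, prime p -> elementary_abelian T p -> ~~ (p %| m + 1))].
Proof.
tfae.
- exact: primitive_quasiprimitive.
- move=> qG; split; first exact: quasiprimitive_characteristically_simple qG.
  by move=> p _; exact: quasiprimitive_elementary_abelian.
- by move=> [cT Tp]; exact: diagonal_primitive.
Qed.
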